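(* Let $A$ be a non-degenerate evolution algebra of dimension $n$ over a field $\mathbb{K}$ with one-dimensional socle and $\mathrm{Soc}(A)^2=0$. Then there is an $(n-1)$-dimensional evolution algebra $B$ endowed with an inner product $\langle\cdot,\cdot\rangle:B\times B\to\mathbb{K}$ and a linear map $\varphi:B\to\mathbb{K}$ such that $A\cong\mathrm{Adj}_4(B,\langle\cdot,\cdot\rangle,\varphi)$.
   Context: An evolution algebra over $\mathbb{K}$ is a finite-dimensional (not necessarily associative) $\mathbb{K}$-algebra with a basis $\{e_i\}$ (a natural basis) with $e_ie_j=0$ for $i\ne j$; it is non-degenerate if $\mathrm{ann}(A)=\{x:xA=Ax=0\}=0$, equivalently $e_i^2\neq0$ for all $i$. $\mathrm{Soc}(A)$ is the sum of all minimal ideals $I$ of $A$ with $AI\neq\{0\}$. An inner product is a symmetric bilinear form (possibly degenerate). $\mathrm{Adj}_4(B,\langle\cdot,\cdot\rangle,\varphi)$ is the vector space $\mathbb{K}\times B$ with product $(\lambda,b)(\lambda',b')=(\langle b,b'\rangle+\lambda\varphi(b')+\lambda'\varphi(b),\ bb')$. *)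

(* Defs.v *)
From HB Require Import structures.
From mathcomp Require Import all_boot all_order all_algebra.
From mathcomp Require Import boolp ring.

Set Implicit Arguments.
Unset Strict Implicit.
Unset Printing Implicit Defensive.

Import GRing.Theory.
Local Open Scope ring_scope.

(* Finite-dimensional algebras over a field, with a bilinear product that is
   not assumed to be associative, commutative or unital.  The algebra
   structures of ssralg and falgebra cannot be used because they are all
   associative. *)
HB.mixin Record hasBilinearProduct (K : fieldType) A of Vector K A := {
  nmul : {bilinear A -> A -> A}
}.

#[short(type="nalgType")]
HB.structure Definition NAlgebra (K : fieldType) :=
  {A of Vector K A & hasBilinearProduct K A}.

Notation "x ** y" := (nmul x y) (at level 40, left associativity) : ring_scope.

Section Ideals.
Variables (K : fieldType) (A : nalgType K).
Implicit Types (x y : A) (U V W I J : {vspace A}).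

Definition nprodv U V : {vspace A} :=
  <<[seq x ** y | x <- vbasis U, y <- vbasis V]>>%VS.

Lemma memv_nmul U V x y : x \in U -> y \in V -> x ** y \in nprodv U V.
Proof.
move=> Ux Vy; rewrite (coord_vbasis Ux) (coord_vbasis Vy).
rewrite linear_sumlz; apply: memv_suml => i _.
rewrite linear_sumr; apply: memv_suml => j _ /=.
rewrite linearZl_LR linearZr_LR; do 2!apply: memvZ; apply: memv_span.
by apply: allpairs_f; apply: mem_nth; rewrite size_tuple.
Qed.

Lemma nprodvP U V W :
  reflect (forall x y, x \in U -> y \in V -> x ** y \in W) (nprodv U V <= W)%VS.
Proof.
apply: (iffP idP) => [sUVW x y Ux Vy | sUVW].
  by apply: (subvP sUVW); apply: memv_nmul.
apply/span_subvP => _ /allpairsP[[x y] /= [Ux Vy ->]].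
by apply: sUVW; apply: vbasis_mem.
Qed.

Definition ideal I := (nprodv fullv I <= I)%VS && (nprodv I fullv <= I)%VS.

Definition minimal_ideal I :=
  [/\ ideal I, I != 0%VS
    & forall J, ideal J -> J != 0%VS -> (J <= I)%VS -> J = I].

Lemma ex_sum_subspaces (P : {vspace A} -> Prop) :
  exists S : {vspace A}, forall x, x \in S <->
    exists2 s : seq {vspace A},
      (forall I, I \in s -> P I) & x \in (\sum_(I <- s) I)%VS.
Proof.
pose Q d := `[< exists2 s : seq {vspace A},
  (forall I, I \in s -> P I) & \dim (\sum_(I <- s) I)%VS = d >].
have Q0 : exists d, Q d.
  by exists 0%N; apply/asboolP; exists [::] => //; rewrite big_nil dimv0.
have Qle d : Q d -> (d <= \dim {:A})%N.
  by move=> /asboolP[s _ <-]; apply: dimvS; apply: subvf.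
case: (ex_maxnP Q0 Qle) => d /asboolP[s Ps dim_s] max_d.
exists (\sum_(I <- s) I)%VS => x; split=> [sx | [t Pt tx]]; first by exists s.
have Pst I : I \in s ++ t -> P I by rewrite mem_cat => /orP[/Ps|/Pt].
have sub_s : (\sum_(I <- s) I <= \sum_(I <- s ++ t) I)%VS.
  by rewrite big_cat /= addvSl.
have /eqP-> : (\sum_(I <- s) I)%VS == (\sum_(I <- s ++ t) I)%VS.
  by rewrite eqEdim sub_s dim_s max_d //; apply/asboolP; exists (s ++ t).
by rewrite big_cat /=; apply: (subvP (addvSr _ _)).
Qed.

(* The sum of an arbitrary, possibly infinite, family of subspaces: all the
   finite sums of vectors of members of the family, see sum_subspacesP. *)
Definition sum_subspaces (P : {vspace A} -> Prop) : {vspace A} :=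
  sval (cid (ex_sum_subspaces P)).

Lemma sum_subspacesP (P : {vspace A} -> Prop) x :
  x \in sum_subspaces P <->
    exists2 s : seq {vspace A},
      (forall I, I \in s -> P I) & x \in (\sum_(I <- s) I)%VS.
Proof. exact: (svalP (cid (ex_sum_subspaces P))). Qed.

Definition soc : {vspace A} :=
  sum_subspaces (fun I => minimal_ideal I /\ nprodv fullv I != 0%VS).

Definition in_ann x := forall y, x ** y = 0 /\ y ** x = 0.

Definition nondegenerate_algebra := forall x, in_ann x -> x = 0.

Definition natural_basis n (e : n.-tuple A) :=
  basis_of fullv e /\ forall i j : 'I_n, i != j -> tnth e i ** tnth e j = 0.

Definition evolution_algebra := exists n (e : n.-tuple A), natural_basis e.

End Ideals.

Arguments soc {K} A.
Arguments nondegenerate_algebra {K} A.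
Arguments evolution_algebra {K} A.

Definition algebra_iso (K : fieldType) (A A' : nalgType K) :=
  exists f : {linear A -> A'},
    bijective f /\ forall x y : A, f (x ** y) = f x ** f y.

Section Adjunction.
Variables (K : fieldType) (B : nalgType K).
Variables (ip : {symmetric B}) (phi : {linear B -> K^o}).

(* The algebra Adj_4(B, ip, phi).  The parameters ip and phi occur only in its
   product, so they are kept as phantom arguments of the carrier. *)
Definition adj4 of {symmetric B} & {linear B -> K^o} : Type := (K^o * B)%type.

HB.instance Definition _ := Vector.copy (adj4 ip phi) (K^o * B)%type.

Definition adj4_mul (u v : adj4 ip phi) : adj4 ip phi :=
  (ip u.2 v.2 + u.1 * phi v.2 + v.1 * phi u.2, u.2 ** v.2).

Lemma adj4_mul_bilinear : bilinear_for *:%R *:%R adj4_mul.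
Proof.
have phiP a b b' : phi (a *: b + b') = a * phi b + phi b' by rewrite linearP.
split=> [v a u u' | v a u u']; rewrite /adj4_mul; congr pair => /=.
- by rewrite linearDl linearZl_LR phiP /GRing.scale /=; ring.
- by rewrite linearDl linearZl_LR.
- by rewrite linearDr linearZr_LR phiP /GRing.scale /=; ring.
- by rewrite linearDr linearZr_LR.
Qed.

HB.instance Definition _ :=
  bilinear_isBilinear.Build K (adj4 ip phi) (adj4 ip phi) (adj4 ip phi)
    *:%R *:%R adj4_mul adj4_mul_bilinear.

HB.instance Definition _ :=
  hasBilinearProduct.Build K (adj4 ip phi) adj4_mul.

End Adjunction.

(* Main.v *)
Require Import Defs.
From HB Require Import structures.
From mathcomp Require Import all_boot all_order all_algebra.
From mathcomp Require Import ring.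

Set Implicit Arguments.
Unset Strict Implicit.
Unset Printing Implicit Defensive.

Import GRing.Theory.
Local Open Scope ring_scope.

(** The socle is an ideal, so here it is a line spanned by some s with
    s ** s = 0, and s ** x is a multiple of s for every x.  Take B to be the
    quotient of A by this line.  The images of a natural basis of A span B and
    are pairwise orthogonal for the product, so any basis of B extracted from
    them is natural ([evolution_algebra_image]).

    Now choose a linear section i of the projection p : A -> B.  Each x is
    c x *: s + i (p x) for a unique scalar c x, and expanding the product of
    two such decompositions, with s ** s = 0 and A commutative, leaves as the
    s-component of x ** y exactly
      c (i (p x) ** i (p y)) + c x * c (s ** i (p y)) + c y * c (s ** i (p x)).
    This is the product of adj4 for the inner product c (i b ** i b') and the
    form c (s ** i b) on B; [adj4_extension] proves that every such extension
    of B by a line of square zero is an adj4. *)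

(** * The socle is an ideal *)

Section Ideals.
Variables (K : fieldType) (A : nalgType K).
Implicit Types (x y : A) (I J : {vspace A}).

Lemma idealP I :
  reflect (forall x y, y \in I -> x ** y \in I /\ y ** x \in I) (ideal I).
Proof.
apply: (iffP andP) => [[/nprodvP lI /nprodvP rI] x y yI | idI].
  by split; [apply: lI | apply: rI]; rewrite ?memvf.
split; apply/nprodvP => x y.
  by move=> _ yI; case: (idI x y yI).
by move=> xI _; case: (idI y x xI).
Qed.

Lemma ideal0 : ideal (0%VS : {vspace A}).
Proof.
apply/idealP => x y; rewrite memv0 => /eqP->.
by rewrite linear0r linear0l mem0v.
Qed.

Lemma ideal_add I J : ideal I -> ideal J -> ideal (I + J)%VS.
Proof.
move=> /idealP idI /idealP idJ; apply/idealP => x _ /memv_addP[u uI [v vJ ->]].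
have [xu ux] := idI x u uI; have [xv vx] := idJ x v vJ.
by rewrite linearDr linearDl; split; apply: memv_add.
Qed.

Lemma ideal_sum_subspaces (P : {vspace A} -> Prop) :
  (forall I, P I -> ideal I) -> ideal (sum_subspaces P).
Proof.
move=> idP; apply/idealP => x y /sum_subspacesP[s Ps ys].
have /idealP/(_ x y ys)[xy yx] : ideal (\sum_(I <- s) I)%VS.
  by rewrite big_seq; apply: (big_ind (@ideal K A)) => [|I J|I /Ps/idP //];
     [apply: ideal0 | apply: ideal_add].
by split; apply/sum_subspacesP; exists s.
Qed.

Lemma ideal_soc : ideal (soc A).
Proof. by apply: ideal_sum_subspaces => I [[]]. Qed.

End Ideals.

(** * Evolution algebras and their images *)

(** Both orders are required so that a single [pairwise] condition, which
    subsequences inherit, covers all pairs of distinct indices. *)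
Definition annihilating (K : fieldType) (A : nalgType K) : rel A :=
  fun x y => (x ** y == 0) && (y ** x == 0).

Lemma basis_subseq (K : fieldType) (V : vectType K) (X : seq V) :
  exists2 Y, subseq Y X & basis_of <<X>>%VS Y.
Proof.
elim: X => [|x X [Y sYX /andP[/eqP spanY freeY]]].
  by exists [::]; rewrite // /basis_of eqxx nil_free.
have [xX | xX] := boolP (x \in <<X>>%VS).
  exists Y; first exact: subseq_trans sYX (subseq_cons X x).
  by rewrite /basis_of freeY spanY span_cons (addv_idPr _) ?eqxx // -memvE.
exists (x :: Y); first by rewrite /= eqxx.
by rewrite /basis_of free_cons !span_cons spanY xX freeY eqxx.
Qed.

Section Evolution.
Variables (K : fieldType).
Implicit Types A B : nalgType K.

(** Being spanned by a mutually annihilating family suffices: a basis extracted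
    from it is still mutually annihilating. *)
Lemma evolution_algebra_span A (X : seq A) :
  <<X>>%VS = fullv -> pairwise (@annihilating K A) X -> evolution_algebra A.
Proof.
move=> spanX annX; have [Y sYX] := basis_subseq X; rewrite spanX => basisY.
exists (size Y), (in_tuple Y); split=> // i j ij.
have /pairwiseP annY := subseq_pairwise sYX annX.
rewrite !(tnth_nth 0) /=; move: ij; rewrite neq_ltn => /orP[] lt_ij.
  by have /andP[/eqP] := annY 0 i j (ltn_ord i) (ltn_ord j) lt_ij.
by have /andP[_ /eqP] := annY 0 j i (ltn_ord j) (ltn_ord i) lt_ij.
Qed.

Lemma evolution_algebra_image A B (p : {linear A -> B}) :
    {morph p : x y / x ** y >-> x ** y} -> (forall b, exists a, p a = b) ->
  evolution_algebra A -> evolution_algebra B.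
Proof.
move=> pM p_onto [n [e [/andP[/eqP spanE _] annE]]].
apply: (@evolution_algebra_span B (map p e)).
  apply/vspaceP => b; rewrite memvf; have [a <-] := p_onto b.
  have: a \in <<e>>%VS by rewrite spanE memvf.
  move=> /coord_span->; rewrite linear_sum; apply: memv_suml => i _.
  rewrite linearZ; apply/memvZ/memv_span/map_f/mem_nth.
  by rewrite size_tuple.
rewrite pairwise_map; apply/(pairwiseP 0) => i j; rewrite !inE size_tuple.
move=> lt_i lt_j lt_ij; rewrite /annihilating /= -!pM.
have := annE (Ordinal lt_i) (Ordinal lt_j).
have := annE (Ordinal lt_j) (Ordinal lt_i).
rewrite !(tnth_nth 0) /= -!val_eqE /= (ltn_eqF lt_ij) eq_sym (ltn_eqF lt_ij).
by move=> -> // -> //; rewrite linear0 eqxx.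
Qed.

(** In coordinates over a natural basis, only the squares of the basis vectors
    survive in a product, with coefficients that are symmetric in x and y. *)
Lemma evolution_algebra_comm A :
  evolution_algebra A -> commutative (fun x y : A => x ** y).
Proof.
move=> [n [e [basisE annE]]] x y.
rewrite (coord_basis basisE (memvf x)) (coord_basis basisE (memvf y)).
rewrite !linear_sumlz; under eq_bigr do rewrite linear_sumr.
rewrite exchange_big /=; apply: eq_bigr => j _.
rewrite linear_sumr; apply: eq_bigr => i _.
rewrite !linearZl_LR !linearZr_LR scalerA [RHS]scalerA mulrC; congr (_ *: _).
rewrite -!tnth_nth; have [-> // | ij] := eqVneq i j.
by rewrite !annE // eq_sym.
Qed.

End Evolution.

(** * Quotients by ideals *)

(** The multiplication carried to V along p with lifts taken by i; it makes p
    multiplicative as soon as the lifting error x - i (p x) stays in an ideal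
    killed by p. *)
Section Transport.
Variables (K : fieldType) (A : nalgType K) (V : vectType K).
Variables (p : {linear A -> V}) (i : {linear V -> A}).

Definition transported of {linear A -> V} & {linear V -> A} : Type := V.

HB.instance Definition _ := Vector.copy (transported p i) V.

Definition transported_mul (b b' : transported p i) : transported p i :=
  p (i b ** i b').

Lemma transported_mul_bilinear : bilinear_for *:%R *:%R transported_mul.
Proof.
split=> [v a u u' | v a u u']; rewrite /transported_mul linearP.
  by rewrite linearDl linearZl_LR linearP.
by rewrite linearDr linearZr_LR linearP.
Qed.

HB.instance Definition _ :=
  bilinear_isBilinear.Build K (transported p i) (transported p i)
    (transported p i) *:%R *:%R transported_mul transported_mul_bilinear.

HB.instance Definition _ :=
  hasBilinearProduct.Build K (transported p i) transported_mul.

End Transport.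

(** The quotient is realised on a complement of I, on which the product of A is
    projected along I. *)
Lemma quotient_algebra (K : fieldType) (A : nalgType K) (I : {vspace A}) :
  ideal I -> exists (B : nalgType K) (p : {linear A -> B}),
    [/\ {morph p : x y / x ** y >-> x ** y}, forall b, exists a, p a = b
      & forall x, (p x == 0) = (x \in I)].
Proof.
move=> /idealP idI.
pose q x := vsproj I^C%VS (x - projv I x).
have q_lin : linear q.
  move=> a x y; rewrite /q -linearP; congr vsproj.
  by rewrite linearP scalerBr addrACA opprD.
pose qm := GRing.isLinear.Build K A (subvs_of I^C%VS) *:%R q q_lin.
pose p : {linear A -> subvs_of I^C%VS} := HB.pack q qm.
pose i : {linear subvs_of I^C%VS -> A} := @vsval K A I^C%VS.
have pK x : i (p x) = x - projv I x by rewrite /i /p /= /q vsprojK ?memv_projC.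
have p_ker x : (p x == 0) = (x \in I).
  apply/eqP/idP => [px0 | xI].
    have /eqP := pK x; rewrite px0 linear0 eq_sym subr_eq0 => /eqP->.
    exact: memv_proj.
  by rewrite /p /= /q projv_id // subrr linear0.
have iK b : p (i b) = b.
  apply: val_inj; rewrite -[LHS]/(i (p (i b))) pK.
  have /eqP-> : projv I (i b) == 0.
    by rewrite -memv_ker lker_proj; apply: subvsP.
  by rewrite subr0.
exists (transported p i : nalgType K), (p : {linear A -> transported p i}).
split=> [x y|b|//]; last by exists (i b).
apply/eqP; rewrite -subr_eq0 -[_ ** _ in X in _ - X]/(p (i (p x) ** i (p y))).
rewrite -linearB p_ker.
(* Each term has a factor in I, namely the lifting error of x or of y. *)
have -> : x ** y - i (p x) ** i (p y) =
    projv I x ** y + i (p x) ** projv I y.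
  by rewrite -{1}[x](subrK (projv I x)) -pK linearDl addrAC -linearBr
    [i (p y)]pK subKr addrC.
apply: rpredD.
  by case: (idI y _ (memv_proj I x)).
by case: (idI (i (p x)) _ (memv_proj I y)).
Qed.

(** * Extensions by a line of square zero *)

(** When i is a section of an extension by a line and c is the coordinate on that
    line, this form is the inner product of the adjunction. *)
Lemma symmetric_product_form (K : fieldType) (A : nalgType K) (V : vectType K)
    (i : {linear V -> A}) (c : {linear A -> K^o}) :
  commutative (fun x y : A => x ** y) ->
  exists ip : {symmetric V}, forall b b', ip b b' = c (i b ** i b').
Proof.
move=> mulC; pose f (b b' : V) : K := c (i b ** i b').
have f_bil : bilinear_for *%R (idfun \; *%R) f.
  split=> [v a u u' | v a u u']; rewrite /f linearP.
    by rewrite linearDl linearZl_LR linearP.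
  by rewrite linearDr linearZr_LR linearP.
have f_sym b b' : f b b' = (-1) ^+ false * idfun (f b' b).
  by rewrite expr0 mul1r /= /f mulC.
pose fB := bilinear_isBilinear.Build K V V K *%R (idfun \; *%R) f f_bil.
pose fS := isHermitianSesquilinear.Build K V false idfun f f_sym.
by pose ip : {symmetric V} := HB.pack f fB fS; exists ip.
Qed.

(** Any section i of p splits A as the line of s plus i @: B.  As p s = 0, the
    products s ** i b fall in the kernel of p, hence are multiples of s, while
    i b ** i b' has p-image b ** b' and some s-component: those two scalars are
    phi and ip, and s ** s = 0 leaves nothing else. *)
Lemma adj4_extension (K : fieldType) (A B : nalgType K)
    (p : {linear A -> B}) (s : A) :
    commutative (fun x y : A => x ** y) ->
    {morph p : x y / x ** y >-> x ** y} -> (forall b, exists a, p a = b) ->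
    (forall x, (p x == 0) = (x \in <[s]>%VS)) -> s != 0 -> s ** s = 0 ->
  exists (ip : {symmetric B}) (phi : {linear B -> K^o}),
    algebra_iso A (adj4 ip phi).
Proof.
move=> mulC pM p_onto p_ker s_neq0 ss0.
pose i : {linear B -> A} := (linfun p)^-1%VF.
have iK b : p (i b) = b.
  have [a <-] := p_onto b; rewrite -(lfunE p) limg_lfunVK //.
  by rewrite -[p a](lfunE p) memv_img ?memvf.
have p_s : p s = 0 by apply/eqP; rewrite p_ker memv_line.
have [c [split_x c_s c_i]] : exists c : {linear A -> K^o},
    [/\ forall x, x = (c x : K) *: s + i (p x), c s = 1
      & forall b, c (i b) = 0].
  pose c x : K^o := coord [tuple s] 0 (x - i (p x)).
  have c_lin : linear c.
    move=> a x y; rewrite /c -[RHS]linearP; congr (coord [tuple s] 0 _).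
    by rewrite (linearP p) (linearP i) scalerBr addrACA opprD.
  pose cL : {linear A -> K^o} :=
    HB.pack c (GRing.isLinear.Build K A K^o *:%R c c_lin).
  exists cL; rewrite /cL /= /c; split=> [x||b].
  - have: x - i (p x) \in <<[tuple s]>>%VS.
      by rewrite span_seq1 -p_ker linearB iK subrr.
    by move=> /coord_span; rewrite big_ord1 /= => /(canRL (subrK _)).
  - rewrite p_s (linear0 i) subr0.
    have free_s : free [tuple s] by rewrite seq1_free.
    by have := coord_free 0 0 free_s; rewrite eqxx.
  - by rewrite iK subrr linear0.
have [ip ipE] := symmetric_product_form i c mulC.
have phi_lin : linear (fun b => c (s ** i b)).
  by move=> a b b'; rewrite linearP linearDr linearZr_LR linearP.
pose phi : {linear B -> K^o} :=
  HB.pack (fun b => c (s ** i b))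
    (GRing.isLinear.Build K B K^o *:%R _ phi_lin).
exists ip, phi.
pose f x : adj4 ip phi := (c x, p x).
have f_lin : linear f by move=> a x y; rewrite /f !linearP.
pose fL : {linear A -> adj4 ip phi} :=
  HB.pack f (GRing.isLinear.Build K A (adj4 ip phi) *:%R f f_lin).
exists fL; split.
  exists (fun u : adj4 ip phi => (u.1 : K) *: s + i u.2) => [x | [l b]] /=.
    by rewrite -split_x.
  rewrite /f !linearD !linearZ /= c_s c_i p_s iK scaler0 add0r addr0.
  by rewrite /GRing.scale /= mulr1.
move=> x y; congr pair; last exact: pM.
rewrite {1}[x]split_x {1}[y]split_x !(linearDl, linearDr).
rewrite !linearZl_LR !linearZr_LR ss0 !scaler0 add0r [i (p x) ** s]mulC.
by rewrite !linearD !linearZ /= ipE /GRing.scale /=; ring.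
Qed.

Theorem theorem6p24 (K : fieldType) (A : nalgType K) (n : nat) :
  evolution_algebra A -> nondegenerate_algebra A -> \dim {:A} = n ->
  \dim (soc A) = 1%N -> nprodv (soc A) (soc A) = 0%VS ->
  exists (B : nalgType K) (ip : {symmetric B}) (phi : {linear B -> K^o}),
    [/\ evolution_algebra B, \dim {:B} = (n - 1)%N
      & algebra_iso A (adj4 ip phi)].
Proof.
move=> evA _ dimA dim_soc soc2.
have [B [p [pM p_onto p_ker]]] := quotient_algebra (@ideal_soc K A).
pose s := vpick (soc A).
have s_soc : s \in soc A := memv_pick _.
have s_neq0 : s != 0 by rewrite vpick0 -dimv_eq0 dim_soc.
have socE : soc A = <[s]>%VS.
  by apply/esym/eqP; rewrite eqEdim -memvE s_soc dim_soc dim_vline s_neq0.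
have ss0 : s ** s = 0 by apply/eqP; rewrite -memv0 -soc2 memv_nmul.
have ker_s x : (p x == 0) = (x \in <[s]>%VS) by rewrite p_ker socE.
have [ip [phi isoA]] :=
  adj4_extension (evolution_algebra_comm evA) pM p_onto ker_s s_neq0 ss0.
exists B, ip, phi; split=> //.
  exact: evolution_algebra_image pM p_onto evA.
have kerE : lker (linfun p) = soc A.
  by apply/vspaceP => x; rewrite memv_ker lfunE p_ker.
have imE : limg (linfun p) = fullv.
  apply/vspaceP => b; rewrite memvf; have [a <-] := p_onto b.
  by rewrite -[p a](lfunE p) memv_img ?memvf.
by rewrite -dimA -(limg_ker_dim (linfun p) fullv) capfv kerE imE dim_soc addKn.
Qed.
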